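(* Let $(G,+,0,d)$ be a strictly convex metric group that is compactly finite-dimensional. Then $G$ is abelian.
   Context: A metric space $(X,d)$ is strictly convex if for any points $x,y\in X$ and any positive real numbers $a,b$ with $a+b=d(x,y)$, the intersection $B[x,a]\cap B[y,b]$ is a singleton, where $B[x,a]=\{z\in X: d(x,z)\le a\}$. A metric group is a (not necessarily commutative, additively written) group $(G,+,0)$ equipped with a metric $d:G\times G\to\mathbb{R}$ such that $d(x+c,y+c)=d(x,y)=d(c+x,c+y)$ for all $x,y,c\in G$. It is strictly convex if the metric space $(G,d)$ is strictly convex. A metric group $G$ is compactly finite-dimensional if $\operatorname{co-dim}(G)=\sup\{\dim(K): K\text{ is a compact subspace of }G\}$ is finite, where $\dim$ is the topological (covering) dimension. *)

(* Defs.v *)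
From HB Require Import structures.
From mathcomp Require Import all_boot all_order all_algebra.
From mathcomp Require Import all_classical all_reals all_analysis.

Set Implicit Arguments.
Unset Strict Implicit.
Unset Printing Implicit Defensive.

Import Order.TTheory GRing.Theory Num.Theory.

Local Open Scope classical_set_scope.
Local Open Scope card_scope.
Local Open Scope ring_scope.

(* The library's additive groups are commutative, so the group law is written
   multiplicatively, on a [groupType]. *)
HB.mixin Record isInvariantMetric (R : realType) G of Metric R G & Group G := {
  mdist_mulgr : forall c x y : G, mdist (x * c)%g (y * c)%g = mdist x y ;
  mdist_mulgl : forall c x y : G, mdist (c * x)%g (c * y)%g = mdist x y
}.

#[short(type="metricGroupType")]
HB.structure Definition MetricGroup (R : realType) :=
  { G of Metric R G & Group G & isInvariantMetric R G }.

(* Not [closed_ball] of the library, which is the closure of the open ball. *)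
Definition mball_le (R : realType) (X : metricType R) (x : X) (a : R) : set X :=
  [set z | mdist x z <= a].

Definition strictly_convex (R : realType) (X : metricType R) : Prop :=
  forall (x y : X) (a b : R), 0 < a -> 0 < b -> a + b = mdist x y ->
    exists z : X, mball_le x a `&` mball_le y b = [set z].

Definition finite_open_cover (T : topologicalType) (U : set (set T)) : Prop :=
  [/\ finite_set U, U `<=` open & \bigcup_(A in U) A = [set: T]].

Definition refines (T : Type) (V U : set (set T)) : Prop :=
  forall B, V B -> exists2 A, U A & B `<=` A.

Definition multiplicity_le (T : Type) (m : nat) (V : set (set T)) : Prop :=
  forall x, [set B | V B /\ B x] #<= `I_m.

(* [covering_dim_lt T m] means dim T <= m - 1. *)
Definition covering_dim_lt (T : topologicalType) (m : nat) : Prop :=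
  forall U : set (set T), finite_open_cover U ->
    exists V : set (set T),
      [/\ finite_open_cover V, refines V U & multiplicity_le m V].

(* Takes values in {-1, 0, 1, ...} and +oo, with -1 only for the empty space. *)
Definition covering_dim (R : realType) (T : topologicalType) : \bar R :=
  ereal_inf [set (m%:R - 1)%:E | m in [set m | covering_dim_lt T m]].

(* [set_type K] carries the subspace topology. *)
Definition compact_dim (R : realType) (X : metricType R) : \bar R :=
  ereal_sup [set covering_dim R (set_type K) | K in [set K : set X | compact K]].

Definition compactly_finite_dimensional (R : realType) (X : metricType R) :
    Prop :=
  compact_dim X \is a fin_num.

(* Main.v *)
(** Let [l x = d(1, x)].  An isometry exchanging
    the endpoints of a segment, or fixing them, fixes its midpoint.  Applied to
    [z |-> a z^-1] this shows that the midpoint of [1] and [a] is a square root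
    of [a]; applied to inversion and to conjugations it shows that there are no
    involutions and that square roots are unique.  Hence [l (a^2) = 2 l a], and
    a conjugation-invariant length with this property vanishes on commutators
    (D. H. J. Polymath, "Homogeneous length functions on groups"): for
    [c = [x^-1, y^-1]] the function [f(m, k) = l (x^m c^k)] satisfies
    [2 f(m, k) <= f(m - 1, k) + f(m + 1, k - 1)], so after [2 n] steps of a
    random walk started at [(0, n)] one gets [n l(c) = O(sqrt n)]. *)
Require Import Defs.
From mathcomp Require Import all_boot all_order all_algebra.
From mathcomp Require Import all_classical all_reals all_analysis.
From mathcomp Require Import ring lra zify.

Import Order.TTheory GRing.Theory Num.Theory.

Local Open Scope ring_scope.

Definition expgz (G : groupType) (x : G) (m : int) : G :=
  match m with Posz n => (x ^+ n)%g | Negz n => (x ^- n.+1)%g end.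

Lemma commute_expgz (G : groupType) (x : G) (m : int) : commute x (expgz G x m).
Proof.
by case: m => n /=; [|apply: commuteV]; apply: commuteX; apply: commute_refl.
Qed.

Lemma expgzDr1 (G : groupType) (x : G) (m : int) :
  expgz G x (m + 1) = (expgz G x m * x)%g.
Proof.
case: m => [n|[|n]]; first by rewrite -PoszD addn1 /= expgSr.
  by rewrite NegzE addNr /= mulVg.
have -> : Negz n.+1 + 1 = Negz n by rewrite !NegzE -addn1 PoszD; ring.
by rewrite /= (expgS _ n.+1) invgM mulgVK.
Qed.

Lemma expgzB1 (G : groupType) (x : G) (m : int) :
  expgz G x m = (x * expgz G x (m - 1))%g.
Proof. by rewrite commute_expgz -expgzDr1 subrK. Qed.

(** Replaces dividing by [n] and letting [n] grow; powers of two suffice, and they are the exponents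
    whose effect on length follows from repeated squaring. *)
Lemma pow2_bounded_le0 (R : realType) (a b : R) :
  (forall i, 2 ^+ i * a <= b) -> a <= 0.
Proof.
move=> ab; rewrite leNgt; apply/negP => a0.
have b0 : 0 <= b by rewrite (le_trans _ (ab 0%N))// expr0 mul1r ltW.
have := archi_boundP (divr_ge0 b0 (ltW a0)); set i := Num.bound _ => bi.
have := ab i; rewrite leNgt => /negP; apply.
rewrite -ltr_pdivrMr//; apply: lt_trans bi _.
by rewrite -natrX ltr_nat ltn_expl.
Qed.

Section SquareHomogeneousLength.
Context (R : realType) (G : groupType) (l : G -> R).
Hypothesis lM : forall x y, l (x * y)%g <= l x + l y.
Hypothesis lV : forall x, l x^-1%g = l x.
Hypothesis lJ : forall x y, l (x ^ y)%g = l x.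
Hypothesis lsqr : forall x, l (x * x)%g = 2 * l x.

Let l1 : l 1%g = 0.
Proof. by have := lsqr 1%g; rewrite mulg1; lra. Qed.

Let l_ge0 x : 0 <= l x.
Proof. by have := lM x x^-1%g; rewrite mulgV l1 lV; lra. Qed.

Lemma length_mulC x y : l (x * y)%g = l (y * x)%g.
Proof. by rewrite -(lJ (x * y)%g x) conjgE -mulgA mulKg. Qed.

Lemma length_pow2 x i : l (x ^+ (2 ^ i))%g = 2 ^+ i * l x.
Proof.
elim: i => [|i IH]; first by rewrite expr0 mul1r.
by rewrite expnSr expgnA expg2 lsqr IH exprS mulrA.
Qed.

Lemma length_expg x n : l (x ^+ n)%g <= n%:R * l x.
Proof.
elim: n => [|n IH]; first by rewrite mul0r l1.
by rewrite expgS -natr1 mulrDl mul1r addrC (le_trans (lM _ _))// lerD2l.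
Qed.

Lemma length_expgz x m : l (expgz G x m) <= `|m|%:~R * l x.
Proof. by case: m => n; rewrite /= ?lV; exact: length_expg. Qed.

(** The innermost factors [w y g z w^-1] form a conjugate of [y g z], so each of the [n] layers
    costs only [l y + l z], whatever [w] is. *)
Lemma length_sandwich w y z g n :
  l ((w * y) ^+ n * g * (z * w^-1) ^+ n)%g <= n%:R * (l y + l z) + l g.
Proof.
elim: n g => [|n IH] g; first by rewrite mulg1 mul1g mul0r add0r.
have -> : ((w * y) ^+ n.+1 * g * (z * w^-1) ^+ n.+1 =
  (w * y) ^+ n * ((y * g * z) ^ w^-1) * (z * w^-1) ^+ n)%g.
  by rewrite expgSr expgS conjgE invgK !mulgA.
apply: le_trans (IH _) _; rewrite lJ -natr1.
have := lM (y * g)%g z; have := lM y g; lra.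
Qed.

(* In [a^n a^n = s^-1 (w y)^n (s t^-1) (z w^-1)^n t] the letters [w] and [w^-1]
   cancel in pairs up to conjugation. *)
Lemma length_conj_le a w y z s t :
  a = ((w * y) ^ s)%g -> a = ((z * w^-1) ^ t)%g -> 2 * l a <= l y + l z.
Proof.
move=> as_ at_; rewrite -subr_le0.
apply: (@pow2_bounded_le0 _ _ (2 * l s + 2 * l t)) => i.
have := length_sandwich w y z (s * t^-1)%g (2 ^ i)%N.
have -> : ((w * y) ^+ (2 ^ i) * (s * t^-1) * (z * w^-1) ^+ (2 ^ i) =
    s * (a ^+ (2 ^ i) * a ^+ (2 ^ i)) * t^-1)%g.
  by rewrite {1}as_ at_ -!conjXg !conjgE !mulgA mulgV mul1g !mulgK.
set A := (a ^+ _)%g; have lA : l (A * A)%g = 2 * (2 ^+ i * l a).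
  by rewrite lsqr length_pow2.
set B := (s * (A * A) * t^-1)%g.
have AB : (A * A = s^-1 * B * t)%g by rewrite /B !mulgA mulVg mul1g mulgVK.
have := lM (s^-1 * B)%g t; have := lM s^-1%g B; rewrite -AB lA lV.
have := lM s t^-1%g; rewrite lV natrX; lra.
Qed.

Lemma length_walk_step x y m k (c := (x * (x^-1 ^ y^-1))%g) :
  2 * l (expgz G x m * expgz G c k)%g <=
  l (expgz G x (m - 1) * expgz G c k)%g +
  l (expgz G x (m + 1) * expgz G c (k - 1))%g.
Proof.
have -> : l (expgz G x (m + 1) * expgz G c (k - 1))%g =
    l ((expgz G x m * expgz G c (k - 1) * x) ^ y)%g.
  by rewrite lJ expgzDr1 -commute_expgz -mulgA length_mulC.
(* In [a = x^m c^k] the factor [w = x] comes off the left end directly; as [c^k = c^(k-1) c] and [c]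
   ends in [x^-1 ^ y^-1], the conjugate [a ^ y] ends in [w^-1]. *)
apply: (@length_conj_le _ x _ _ 1%g y^-1%g).
  by rewrite conjg1 mulgA -expgzB1.
rewrite (conjMg _ x^-1%g) conjgK -!mulgA -/c; congr (_ * _)%g.
by rewrite expgzB1 commute_expgz.
Qed.

(* The function [e (m^2 + j) + C^2 / (16 e)] dominates [l] at time [j = 0] and is
   harmonic for the walk, along which [m + 2 k] decreases by [1]. *)
Lemma length_walk_bound x y (c := (x * (x^-1 ^ y^-1))%g) (e : R) (j : nat) m k :
  0 < e -> m + 2 * k = j%:Z ->
  l (expgz G x m * expgz G c k)%g <=
  e * (m%:~R ^+ 2 + j%:R) + (2 * l x + l c) ^+ 2 / (16 * e).
Proof.
move=> e0; elim: j m k => [|j IH] m k mk.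
  have mE : m = - (2 * k) by lia.
  have := lM (expgz G x m) (expgz G c k).
  have := length_expgz x m; have := length_expgz c k.
  set C := 2 * l x + l c; set K : R := `|k|%:~R.
  have -> : `|m|%:~R = 2 * K :> R.
    by rewrite mE normrN normrM intrM.
  have -> : m%:~R ^+ 2 = 4 * K ^+ 2 :> R.
    by rewrite /K intr_norm real_normK ?num_real// mE mulrNz intrM; ring.
  (* This square bounds the estimate [K * C] from the triangle inequality by the claimed bound at
     [m = - 2 k]. *)
  have : 0 <= (8 * e * K - C) ^+ 2 / (16 * e).
    by rewrite divr_ge0 ?sqr_ge0// mulr_ge0// ltW.
  have -> : (8 * e * K - C) ^+ 2 / (16 * e) =
      4 * e * K ^+ 2 - K * C + C ^+ 2 / (16 * e).
    by field; rewrite gt_eqF.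
  rewrite /C; lra.
have /= := length_walk_step x y m k; rewrite -/c.
have := IH (m - 1) k ltac:(lia); have := IH (m + 1) (k - 1) ltac:(lia).
rewrite intrB intrD -(natr1 j); set M : R := m%:~R; lra.
Qed.

Lemma length_commutator_eq0 x y : l (x * (x^-1 ^ y^-1))%g = 0.
Proof.
apply/eqP; rewrite eq_le l_ge0 andbT leNgt; apply/negP.
set c := (x * _)%g => c0.
have : l c / 2 <= 0; last lra.
apply: (@pow2_bounded_le0 _ _ ((2 * l x + l c) ^+ 2 / (4 * l c))) => i.
(* With [e = l c / 4] and [2 * 2 ^ i] steps, the growing term of the bound is half of [2 ^ i * l c];
   the other term is independent of [i]. *)
have e0 : 0 < l c / 4 by lra.
have := @length_walk_bound x y (l c / 4) (2 * 2 ^ i) 0 (2 ^ i)%N%:Z e0 erefl.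
rewrite -/c mul1g /= length_pow2 natrM natrX.
have -> : 16 * (l c / 4) = 4 * l c by lra.
by rewrite expr0n /=; lra.
Qed.

End SquareHomogeneousLength.

Section StrictlyConvexMetricGroup.
Context (R : realType) (G : metricGroupType R).
Hypothesis hconvex : strictly_convex G.
Implicit Types a x y : G.

Let l x : R := mdist 1%g x.

Lemma mdist_mulV x y : mdist x y = l (x^-1 * y)%g.
Proof. by rewrite /l -(mdist_mulgl x 1%g) mulg1 mulVKg. Qed.

Lemma lengthV x : l x^-1%g = l x.
Proof. by rewrite /l -(mdist_mulgl x) mulg1 mulgV metric_sym. Qed.

Lemma lengthJ x y : l (x ^ y)%g = l x.
Proof.
by rewrite /l conjgE -(mdist_mulgl y) mulVKg mulg1 -{1}(mul1g y) mdist_mulgr.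
Qed.

Lemma lengthM x y : l (x * y)%g <= l x + l y.
Proof.
apply: (le_trans (metric_triangle _ x _)).
by rewrite lerD2l -{1}(mulg1 x) mdist_mulgl.
Qed.

Lemma midpoint_sqr a : a != 1%g -> exists m : G,
  [/\ a = (m * m)%g, l m <= l a / 2 &
  forall z, l z <= l a / 2 -> mdist a z <= l a / 2 -> z = m].
Proof.
move=> a1; have a0 : 0 < l a by rewrite mdist_gt0 eq_sym.
have a20 : 0 < l a / 2 by lra.
have [|m mE] := hconvex 1%g a _ _ a20 a20; first by rewrite -/(l a); lra.
have mP z : (mball_le 1%g (l a / 2) `&` mball_le a (l a / 2))%classic z <->
    z = m by rewrite mE.
have [m1 ma] := (mP m).2 erefl.
exists m; split=> // [|z z1 za]; last exact/mP.
have {1}<- : (a * m^-1 = m)%g; last by rewrite mulgVK.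
apply/mP; split; rewrite /mball_le /=.
  by rewrite -(mdist_mulgr m) mulgVK mul1g metric_sym.
by rewrite -{1}(mulg1 a) mdist_mulgl -/(l _) lengthV.
Qed.

Lemma no_involution a : (a * a = 1)%g -> a = 1%g.
Proof.
move=> aa1; apply/eqP; apply/negPn/negP => a1.
have [m [am m1 m_uniq]] := midpoint_sqr a a1.
(* As [a^-1 = a], inversion fixes [1] and [a], hence [m]. *)
suff mV : (m^-1 = m)%g by move/negP: a1; apply; rewrite am -{1}mV mulVg.
apply: m_uniq; first by rewrite lengthV.
by rewrite -(mdist_mulgr m) mulVg -aa1 mdist_mulgl mdist_mulV {1}am mulKg.
Qed.

Lemma length_sqr a : l (a * a)%g = 2 * l a.
Proof.
apply/eqP; rewrite eq_le; apply/andP; split.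
  by rewrite (le_trans (lengthM _ _))// mulr_natl mulr2n.
have [aa1|aa1] := eqVneq (a * a)%g 1%g.
  by rewrite (no_involution a aa1) mulg1 /l mdistxx mulr0.
have [m [mm m1 m_uniq]] := midpoint_sqr _ aa1.
have maa : mdist (a * a)%g m <= l (a * a)%g / 2.
  by rewrite mdist_mulV {1}mm invgM mulgVK lengthV.
(* Conjugation by [a] fixes [1] and [a * a], hence [m]; then [a * m^-1] squares to [1], so
   [a = m]. *)
have am : commute m a.
  suff /conjg_fixP/commgP : (m ^ a)%g = m by [].
  apply: m_uniq; first by rewrite lengthJ.
  rewrite mdist_mulV -(lengthJ _ a^-1%g) conjMg conjgK conjVg.
  by rewrite (conjMg a) conjgE invgK mulgV mulg1 -mdist_mulV.
suff a_eq_m : a = m by move: m1; rewrite -a_eq_m; lra.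
apply/divg1_eq/no_involution; rewrite -expg2 expgnFl; last exact/commute_sym.
by rewrite !expg2 mm mulgV.
Qed.

End StrictlyConvexMetricGroup.

Theorem corollary41 (R : realType) (G : metricGroupType R)
    (hconvex : strictly_convex G)
    (hdim : compactly_finite_dimensional G) :
  forall x y : G, (x * y)%g = (y * x)%g.
Proof.
move=> x y; apply/commgP.
(* At [x^-1] and [y^-1] the vanishing element is [x^-1 * x ^ y], the commutator of [x] and [y]. *)
have /mdist_positivity := length_commutator_eq0 R G (mdist 1%g)
  (@lengthM R G) (@lengthV R G) (@lengthJ R G) (@length_sqr R G hconvex)
  x^-1%g y^-1%g.
by rewrite !invgK -commgEl => <-.
Qed.
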